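(* Let $f(x,y)\in\mathbb{R}[x,y]$ be a nonzero real binary form of degree $d$ that is not a $d$-th power (i.e. not a scalar multiple of the $d$-th power of a linear form), with the factorization $$f(x,y)=\prod_{i=0}^{r}\ell_i(x,y)^{m_i}\ \prod_{k=0}^{s}p_k(x,y)^{n_k},$$ where the $\ell_i$ are distinct (pairwise non-proportional) nonzero real binary linear forms, the $p_k$ are distinct (pairwise non-proportional) irreducible real quadratic forms, and the exponents $m_i,n_k$ are positive integers; either of the two products is allowed to be empty. Then $$L_{\mathbb{R}}(f)\ \ge\ \max\Bigl(\sum_{i=0}^{r}m_i,\ \max(m_0,\ldots,m_r,n_0,\ldots,n_s)+1\Bigr),$$ where an empty sum is $0$ and the inner maximum is taken over the exponents that occur.
   Context: For a field $K\subseteq\mathbb{C}$ and a binary form (homogeneous polynomial in $x,y$) $f\in K[x,y]$ of degree $d$, the $K$-rank $L_K(f)$ is the smallest $r$ for which there exist $\lambda_j,\alpha_j,\beta_j\in K$ with $f(x,y)=\sum_{j=1}^r\lambda_j(\alpha_jx+\beta_jy)^d$. For $K=\mathbb{R}$ it is called the real Waring rank. *)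

(* Defs.v *)
From HB Require Import structures.
From mathcomp Require Import all_boot all_order all_algebra.
From mathcomp Require Import boolp reals.
From mathcomp Require Import mpoly.

Set Implicit Arguments.
Unset Strict Implicit.
Unset Printing Implicit Defensive.

Import Order.TTheory GRing.Theory Num.Theory.

Local Open Scope ring_scope.

(* A binary form of degree d over K is an element of {mpoly K[2]} that is
   d.-homog; 0 is homogeneous of every degree. *)

Section WaringRank.

(* Subfields of the complex numbers are instances of numFieldType. *)
Variable K : numFieldType.

Implicit Types (d r : nat) (f g : {mpoly K[2]}).

Definition linear_form (a b : K) : {mpoly K[2]} :=
  a *: 'X_ord0 + b *: 'X_ord_max.

Definition waring_decomposable d f r : Prop :=
  exists lam al be : 'I_r -> K,
    f = \sum_(j < r) lam j *: linear_form (al j) (be j) ^+ d.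

(* The default value 0 is never taken when f is homogeneous of degree d:
   see waring_decomposable_ex and waring_rankP. *)
Definition waring_rank d f : nat :=
  if pselect (exists r, `[< waring_decomposable d f r >]) is left h
  then ex_minn h else 0%N.

Definition is_scaled_power d f : Prop :=
  exists (c : K) (l : {mpoly K[2]}), l \is 1.-homog /\ f = c *: l ^+ d.

Definition proportional f g : Prop := exists c : K, f = c *: g.

End WaringRank.

Definition irreducible_element (A : idomainType) (p : A) : Prop :=
  [/\ p != 0, p \isn't a GRing.unit &
      forall q1 q2 : A,
        p = q1 * q2 -> q1 \is a GRing.unit \/ q2 \is a GRing.unit].

Section WaringRankTheory.

Variable K : numFieldType.

Lemma monomial_powers_span d (m : 'X_{1..2}) : mdeg m = d ->
  exists lam : 'I_d.+1 -> K,
    'X_[m] = \sum_(t < d.+1) lam t *: linear_form 1 t%:R ^+ d.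
Proof.
move=> dm.
have md : m ord0 + m ord_max = d by rewrite -dm mdegE big_ord_recl big_ord1 /=;
  congr (_ + m _)%N; apply/val_inj.
pose a : 'rV[K]_d.+1 := \row_t (t : nat)%:R.
pose V : 'M[K]_d.+1 := Vandermonde d.+1 a.
have Vu : V \in unitmx.
  rewrite unitmxE det_Vandermonde unitfE; apply/prodf_neq0 => i _.
  apply/prodf_neq0 => j ij; rewrite !mxE subr_eq0 eqr_nat.
  by rewrite neq_ltn ij orbT.
have lk : (m ord_max < d.+1)%N by rewrite ltnS -md leq_addl.
pose k0 : 'I_d.+1 := Ordinal lk.
pose lam t : K := invmx V t k0 / 'C(d, k0)%:R.
have key (k : 'I_d.+1) : \sum_(t < d.+1) lam t * (t%:R ^+ k * 'C(d, k)%:R)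
    = (k == k0)%:R :> K.
  have := congr1 (fun M : 'M[K]_d.+1 => M k k0) (mulmxV Vu).
  rewrite !mxE => E; transitivity (\sum_j V k j * invmx V j k0 *
      ('C(d, k)%:R / 'C(d, k0)%:R)).
    apply: eq_bigr => j _; rewrite !mxE /lam.
    by rewrite mulrACA [_^-1 * _]mulrC [invmx V j k0 * _]mulrC.
  rewrite -mulr_suml E; case: eqP => [->|_]; last by rewrite mul0r.
  by rewrite mul1r divff // pnatr_eq0 -lt0n bin_gt0 -ltnS ltn_ord.
exists lam; rewrite /linear_form.
under eq_bigr => t _ do rewrite exprDn scaler_sumr.
have inner (k : 'I_d.+1) :
    \sum_(t < d.+1) lam t *: (((1 *: 'X_ord0) ^+ (d - k) *
       (t%:R *: 'X_ord_max) ^+ k) *+ 'C(d, k)) =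
    (k == k0)%:R *: ('X_ord0 ^+ (d - k) * 'X_ord_max ^+ k : {mpoly K[2]}).
  rewrite -key scaler_suml; apply: eq_bigr => t _.
  rewrite scale1r exprZn -scalerAr -scaler_nat !scalerA.
  by congr (_ *: _); rewrite mulrAC -!mulrA.
rewrite exchange_big /= (eq_bigr _ (fun k _ => inner k)) (bigD1 k0) //=.
rewrite big1 => [|k /negPf ->]; last by rewrite scale0r.
rewrite addr0 eqxx scale1r mpolyXE_id big_ord_recl big_ord1.
have -> : lift ord0 ord0 = ord_max :> 'I_2 by apply/val_inj.
by rewrite -[in (d - _)%N]md addnK.
Qed.

Lemma waring_decomposable_ex d (f : {mpoly K[2]}) :
  f \is d.-homog -> exists r, waring_decomposable d f r.
Proof.
move=> /dhomogP fd; exists d.+1.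
suff [lam ->] : exists lam : 'I_d.+1 -> K,
    f = \sum_(t < d.+1) lam t *: linear_form 1 t%:R ^+ d.
  by exists lam, (fun=> 1), (fun t => t%:R).
rewrite [f]mpolyE big_seq.
elim/big_ind: _ => [|g h [l1 ->] [l2 ->]|m /fd dm].
- by exists (fun=> 0); rewrite big1 // => i _; rewrite scale0r.
- exists (fun t => l1 t + l2 t); rewrite -big_split /=.
  by apply: eq_bigr => t _; rewrite scalerDl.
- have [lam E] := monomial_powers_span dm.
  exists (fun t => f@_m * lam t); rewrite {1}E scaler_sumr.
  by apply: eq_bigr => t _; rewrite scalerA.
Qed.

Lemma waring_rankP d (f : {mpoly K[2]}) : f \is d.-homog ->
  waring_decomposable d f (waring_rank d f) /\
  forall r, waring_decomposable d f r -> (waring_rank d f <= r)%N.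
Proof.
move=> /waring_decomposable_ex [r0 fr0]; rewrite /waring_rank.
case: pselect => [h|[]]; last by exists r0; apply/asboolP.
case: ex_minnP => r /asboolP fr rmin; split=> // s fs.
by apply: rmin; apply/asboolP.
Qed.

End WaringRankTheory.

(* Main.v *)
Require Import Defs.
From HB Require Import structures.
From mathcomp Require Import all_boot all_order all_algebra.
From mathcomp Require Import boolp reals.
From mathcomp Require Import mpoly.
From mathcomp Require Import ring zify.
From mathcomp Require Import polyrcf.

Set Implicit Arguments.
Unset Strict Implicit.
Unset Printing Implicit Defensive.

Import Order.TTheory GRing.Theory Num.Theory.

Local Open Scope ring_scope.

(* Let f = sum_j lam_j L_j^d be a shortest decomposition: the lam_j are nonzero,
   the L_j pairwise non-proportional, and it has r >= 2 terms.

   Multiplicities: a first-order operator kills one L_j^d, lowers by one the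
   degrees of the other powers, and lowers by at most one the exponent of a form
   q in f. If q^r divided f, killing all the terms but one would show that q
   divides a power of each L_j, although two of these are coprime.

   Real roots: by Rolle's theorem on the projective line, a directional
   derivative loses at most one real linear factor. Killing r - 2 terms leaves
   lam L^e + lam' L'^e, which has at most two real linear factors. *)

(** * Powers of linear forms in an affine coordinate; the multiplicity bound *)

Section AffinePowers.

Variable F : numFieldType.

Implicit Types (u v w : F * F) (x y : F * (F * F)) (g h q : {poly F}).

(** The form [w.1 X + w.2 Y] at [Y = 1]; a nonzero pair with [w.1 = 0] vanishes only at infinity and
    gives a constant. *)
Definition affine w : {poly F} := w.1 *: 'X + w.2%:P.

Definition det2 u v : F := u.1 * v.2 - u.2 * v.1.

Definition power_term d x : {poly F} := x.1 *: affine x.2 ^+ d.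

Lemma affineE w : affine w = w.1%:P * 'X + w.2%:P.
Proof. by rewrite /affine -mul_polyC. Qed.

Lemma deriv_affine w : (affine w)^`() = w.1%:P.
Proof. by rewrite /affine derivD derivZ derivX derivC addr0 -alg_polyC. Qed.

Lemma det2_neq0l u v : det2 u v != 0 -> u != (0, 0).
Proof. by apply: contra_neq => ->; rewrite /det2 !mul0r subrr. Qed.

Lemma det2xx u : det2 u u = 0.
Proof. by rewrite /det2 mulrC subrr. Qed.

Lemma det2C u v : det2 u v = - det2 v u.
Proof. by rewrite /det2 opprB [u.1 * _]mulrC [u.2 * _]mulrC. Qed.

Lemma size_affine w : (size (affine w) <= 2)%N.
Proof.
rewrite (leq_trans (size_polyD _ _)) // geq_max.
rewrite (leq_trans (size_scale_leq _ _)) ?size_polyX //.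
by rewrite ltnW // ltnS size_polyC_leq1.
Qed.

(** Eliminating ['X] leaves the constant [det2 u v], a Bezout relation. *)
Lemma coprimep_affine u v : det2 u v != 0 -> coprimep (affine u) (affine v).
Proof.
move=> uv0; apply/Bezout_coprimepP; exists ((- v.1)%:P, u.1%:P) => /=.
have -> : (- v.1)%:P * affine u + u.1%:P * affine v = (det2 u v)%:P.
  rewrite !affineE /det2 polyCB !polyCM polyCN; ring.
by rewrite polyC_eqp1.
Qed.

(* In terms of forms of degree [d], this is the derivative in the direction
   on which [affine w] vanishes. *)
Definition polar d w g : {poly F} := (w.1 * d%:R) *: g - affine w * g^`().

Lemma polar_sum d w t :
  polar d w (\sum_(x <- t) power_term d x) =
  \sum_(x <- t) polar d w (power_term d x).
Proof.
by rewrite /polar scaler_sumr raddf_sum mulr_sumr -sumrB.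
Qed.

(** The linear form is kept, so determinants between terms persist; the coefficient vanishes when
    that form is proportional to [w]. *)
Definition polar_term d w x := (x.1 * d%:R * det2 w x.2, x.2).

Lemma polar_power_term d w x :
  polar d.+1 w (power_term d.+1 x) = power_term d (polar_term d.+1 w x).
Proof.
rewrite /polar /power_term /polar_term /= derivZ deriv_exp deriv_affine /=.
rewrite -!mul_polyC -mulr_natl exprS !affineE /det2.
rewrite !polyCM polyCB !polyCM !polyC_natr; ring.
Qed.

Lemma dvdp_polar d w q e g : q ^+ e.+1 %| g -> q ^+ e %| polar d w g.
Proof.
case/dvdpP => p ->; rewrite /polar derivM deriv_exp -mul_polyC.
apply/dvdpP; exists ((w.1 * d%:R)%:P * p * q
  - affine w * (p^`() * q + p * q^`() *+ e.+1)).
rewrite /= -[q^`() * _ *+ _]mulr_natl -[p * q^`() *+ _]mulr_natl !exprS.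
ring.
Qed.

(* Each [polar] operator removes one of the terms of [t] at the cost of one
   factor [q]. *)
Lemma dvdp_pivot d e q x (t : seq (F * (F * F))) :
  x.1 != 0 -> (size t <= d)%N -> all (fun y => det2 x.2 y.2 != 0) t ->
  q ^+ (size t + e) %| \sum_(y <- x :: t) power_term d y ->
  q ^+ e %| affine x.2 ^+ (d - size t).
Proof.
move sz_t: (size t) => n.
elim: n t sz_t d x => [|n IH] [|w t] //= => [_|[sz_t]] d x x0.
  by rewrite big_seq1 /power_term dvdpZr // subn0.
case: d => // d nd /andP[xw xt] /(dvdp_polar d.+1 w.2).
have polar_w : polar d.+1 w.2 (power_term d.+1 w) = 0.
  by rewrite polar_power_term /power_term /polar_term det2xx mulr0 scale0r.
rewrite polar_sum (_ : \sum_(_ <- _) _ =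
  \sum_(y <- x :: t) polar d.+1 w.2 (power_term d.+1 y)); last first.
  by rewrite !big_cons polar_w add0r.
under eq_bigr do rewrite polar_power_term.
rewrite -(big_map (polar_term d.+1 w.2) xpredT (power_term d)) /= subSS => qg.
apply: IH (polar_term d.+1 w.2 x) _ nd _ qg => /=.
- by rewrite size_map.
- by rewrite !mulf_neq0 ?pnatr_eq0 // det2C oppr_eq0.
- by rewrite all_map.
Qed.

Lemma power_sum_multiplicity d e q x y (t : seq (F * (F * F))) :
  x.1 != 0 -> y.1 != 0 -> det2 x.2 y.2 != 0 ->
  all (fun z => det2 x.2 z.2 != 0) t -> all (fun z => det2 y.2 z.2 != 0) t ->
  (1 < size q)%N -> (e <= d)%N ->
  q ^+ e %| \sum_(z <- [:: x, y & t]) power_term d z ->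
  (e < (size t).+2)%N.
Proof.
move=> x0 y0 xy xt yt q1 ed qg; rewrite ltnNge; apply/negP => te.
(* One factor more than the [(size t).+1] terms to be removed, so that [q] itself survives for
   either pivot. *)
have qg2 : q ^+ ((size t).+1 + 1) %| \sum_(z <- [:: x, y & t]) power_term d z.
  by apply: dvdp_trans qg; rewrite dvdp_exp2l // addn1.
have td : ((size t).+1 <= d)%N by apply: leq_trans ed; apply: ltnW.
have qx : q %| affine x.2 ^+ (d - (size t).+1).
  rewrite -[q]expr1; apply: (@dvdp_pivot d 1 q x (y :: t)) => //=.
  by rewrite xy.
have qy : q %| affine y.2 ^+ (d - (size t).+1).
  rewrite -[q]expr1; apply: (@dvdp_pivot d 1 q y (x :: t)) => //=.
    by rewrite det2C oppr_eq0 xy.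
  by move: qg2; rewrite !big_cons addrCA.
have := coprimep_expl (d - (size t).+1) (coprimep_expr (d - (size t).+1)
  (coprimep_affine xy)).
move=> /coprimepP/(_ q qx qy); rewrite -size_poly_eq1 => /eqP q1E.
by rewrite q1E in q1.
Qed.

End AffinePowers.

(** * Substitution into the homogenisation of a polynomial *)

Section Substitution.

Variables (F : numFieldType) (S : comAlgType F).

Implicit Types (g h : {poly F}) (a b : S) (s : seq (F * F)).

(* The value at [(a, b)] of the form of degree [d] whose dehomogenisation
   is [g]. *)
Definition form_subst d g a b : S :=
  \sum_(i < d.+1) g`_i *: (a ^+ i * b ^+ (d - i)).

Lemma form_subst_affine d w g a b : (size g <= d.+1)%N ->
  form_subst d.+1 (affine w * g) a b =
  (w.1 *: a + w.2 *: b) * form_subst d g a b.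
Proof.
move=> gd; rewrite [RHS]mulrDl -!scalerAl /form_subst.
under eq_bigr => i _ do
  rewrite affineE mulrDl -mulrA !mul_polyC coefD !coefZ coefXM scalerDl
    -!scalerA.
rewrite big_split /= -!scaler_sumr; congr (_ *: _ + _ *: _).
- rewrite big_ord_recl eqxx scale0r add0r mulr_sumr; apply: eq_bigr => i _ /=.
  by rewrite subSS exprS -scalerAr mulrA.
(* The size bound makes the coefficient of index [d.+1] vanish. *)
- rewrite big_ord_recr /= nth_default // scale0r addr0 mulr_sumr.
  apply: eq_bigr => i _ /=.
  have id : (i <= d)%N by rewrite -ltnS.
  by rewrite (subSn id) [b ^+ _.+1]exprS -scalerAr mulrCA.
Qed.

Lemma size_prod_affine s k h : (size h <= k.+1)%N ->
  (size (\prod_(w <- s) affine w * h)%R <= (size s + k).+1)%N.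
Proof.
move=> hk; elim: s => [|w s IH]; first by rewrite big_nil mul1r.
rewrite big_cons -mulrA (leq_trans (size_polyMleq _ _)) // -subn1 leq_subLR.
exact: leq_add (size_affine w) IH.
Qed.

Lemma form_subst_prod s k h a b : (size h <= k.+1)%N ->
  form_subst (size s + k) (\prod_(w <- s) affine w * h) a b =
  \prod_(w <- s) (w.1 *: a + w.2 *: b) * form_subst k h a b.
Proof.
move=> hk; elim: s => [|w s IH]; first by rewrite !big_nil !mul1r.
by rewrite !big_cons -!mulrA form_subst_affine ?IH // size_prod_affine.
Qed.

Lemma form_subst_exp d w a b :
  form_subst d (affine w ^+ d) a b = (w.1 *: a + w.2 *: b) ^+ d.
Proof.
have := @form_subst_prod (nseq d w) 0 1 a b.
rewrite size_polyC oner_neq0 size_nseq addn0 !big_nseq !iter_mulr_1 mulr1.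
move=> -> //.
by rewrite /form_subst big_ord1 coefC expr0 expr0 mulr1 scale1r mulr1.
Qed.

Lemma form_substZ d c g a b :
  form_subst d (c *: g) a b = c *: form_subst d g a b.
Proof.
by rewrite scaler_sumr; apply: eq_bigr => i _; rewrite coefZ scalerA.
Qed.

Lemma form_subst_sum d I (r : seq I) (G : I -> {poly F}) a b :
  form_subst d (\sum_(i <- r) G i) a b = \sum_(i <- r) form_subst d (G i) a b.
Proof.
rewrite exchange_big /=; apply: eq_bigr => i _.
by rewrite coef_sum scaler_suml.
Qed.

End Substitution.

(** * Real linear factors under rotation and differentiation *)

Section Rolle.

Variable R : rcfType.

Implicit Types (u v w : R * R) (g h : {poly R}).

(** Coordinates of the form [u] after replacing [X] by [w.2 X + w.1 Y] and [Y] by [- w.1 X + w.2 Y],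
    a rotation up to scaling. It takes [w] to [(0, w.1 ^+ 2 + w.2 ^+ 2)]: the zero of [w] moves to
    infinity. *)
Definition rot w u : R * R := (det2 u w, u.1 * w.1 + u.2 * w.2).

Lemma det2_rot w u v :
  det2 (rot w u) (rot w v) = (w.1 ^+ 2 + w.2 ^+ 2) * det2 u v.
Proof. by rewrite /det2 /rot /det2 /=; ring. Qed.

Lemma sqr_norm_neq0 w : w != (0, 0) -> w.1 ^+ 2 + w.2 ^+ 2 != 0.
Proof.
by case: w => x y; rewrite paddr_eq0 ?sqr_ge0 // !sqrf_eq0 xpair_eqE.
Qed.

Lemma rot_neq0 w u : w != (0, 0) -> u != (0, 0) -> rot w u != (0, 0).
Proof.
move=> w0; apply: contra_neq => E; move: E (sqr_norm_neq0 w0).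
case: u w {w0} => [x y] [z t] [/=]; rewrite /det2 /= => E1 E2 n0.
(* The transposed map recovers [x] and [y], times [z ^+ 2 + t ^+ 2], from the vanishing
   coordinates. *)
congr pair; apply: (mulfI n0); rewrite mulr0.
- transitivity ((x * t - y * z) * t + (x * z + y * t) * z); first by ring.
  by rewrite E1 E2 !mul0r addr0.
- transitivity ((x * z + y * t) * t - (x * t - y * z) * z); first by ring.
  by rewrite E1 E2 !mul0r subr0.
Qed.

(** The degree is an argument because factors at infinity, invisible in [g], may become finite. *)
Definition rotate d w g : {poly R} :=
  form_subst d g (affine (w.2, w.1)) (affine (- w.1, w.2)).

Lemma rot_affine w u :
  u.1 *: affine (w.2, w.1) + u.2 *: affine (- w.1, w.2) = affine (rot w u).
Proof.
rewrite !affineE /rot /det2 /= -!mul_polyC polyCB polyCD !polyCM polyCN.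
ring.
Qed.

Lemma rotate_power_sum d w (t : seq (R * (R * R))) :
  rotate d w (\sum_(x <- t) power_term d x) =
  \sum_(x <- t) power_term d (x.1, rot w x.2).
Proof.
rewrite /rotate form_subst_sum; apply: eq_bigr => x _.
by rewrite form_substZ form_subst_exp rot_affine.
Qed.

(* Linear factors [(0, c)], that is zeros at infinity, are allowed among the
   [d - k] real linear factors. *)
Definition split_up_to d k g : Prop :=
  exists (s : seq (R * R)) h,
    [/\ all (fun w => w != (0, 0)) s, (size s + k)%N = d, (size h <= k.+1)%N
      & g = \prod_(w <- s) affine w * h].

Lemma split_rotate d k w g :
  w != (0, 0) -> split_up_to d k g -> split_up_to d k (rotate d w g).
Proof.
move=> w0 [s [h [s0 <- hk ->]]]; rewrite /rotate form_subst_prod //.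
exists (map (rot w) s),
  (form_subst k h (affine (w.2, w.1)) (affine (- w.1, w.2))).
split.
- by rewrite all_map; apply: sub_all s0 => u; exact: rot_neq0.
- by rewrite size_map.
- rewrite (leq_trans (size_sum _ _ _)) //; apply/bigmax_leqP => i _.
  rewrite (leq_trans (size_scale_leq _ _)) //.
  (* The summand of index [i] is a multiple of a product of [i + (k - i) = k] affine factors. *)
  have := @size_prod_affine R
    (nseq i (w.2, w.1) ++ nseq (k - i) (- w.1, w.2)) 0 1.
  rewrite size_cat !size_nseq big_cat !big_nseq !iter_mulr_1 mulr1 addn0.
  rewrite subnKC -1?ltnS //.
  by rewrite size_polyC oner_neq0; apply.
- by rewrite big_map; congr (_ * _); apply: eq_bigr => u _; rewrite rot_affine.
Qed.

(* Factors at infinity contribute only to the constant. *)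
Lemma prod_affineE (s : seq (R * R)) : all (fun w => w != (0, 0)) s ->
  exists (zs : seq R) (c : R), [/\ c != 0, (size zs <= size s)%N
    & \prod_(w <- s) affine w = c *: \prod_(z <- zs) ('X - z%:P)].
Proof.
elim: s => [|[x y] s IH] /= => [_|/andP[w0 /IH[zs [c [c0 zs_s E]]]]].
  by exists [::], 1; rewrite oner_neq0 scale1r !big_nil.
have [x0|x0] := eqVneq x 0.
  exists zs, (y * c); split; first 1 last.
  - exact: leq_trans zs_s _.
  - by rewrite big_cons E /affine /= x0 scale0r add0r mul_polyC scalerA.
  by rewrite mulf_neq0 //; move: w0; rewrite x0 xpair_eqE eqxx.
exists (- (y / x) :: zs), (x * c); split; rewrite ?mulf_neq0 //.
rewrite !big_cons E affineE /= -!mul_polyC polyCN opprK polyCM !mulrA.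
congr (_ * _).
rewrite -[in LHS](divfK x0 y) !polyCM; ring.
Qed.

Lemma rolle_roots g z (zs : seq R) : path <%R z zs -> all (root g) (z :: zs) ->
  exists ys : seq R, [/\ size ys = size zs, uniq ys, all (root g^`()) ys,
    all (fun y => z < y) ys & all (fun y => y \notin z :: zs) ys].
Proof.
elim: zs z => [|z1 zs IH] z /=; first by exists [::].
move=> /andP[zz1 zs_lt] /and3P[/rootP gz gz1 gzs].
have [] := IH z1 zs_lt; first by rewrite /= gz1.
move=> ys [sys uys rys lys nys].
have [|y yI g'y] := @poly_rolle R z z1 g zz1; first by rewrite gz (rootP gz1).
move: yI; rewrite in_itv /= => /andP[zy yz1].
exists (y :: ys); split=> /=.
- by rewrite sys.
- rewrite uys andbT; apply/negP => /(allP lys) /(lt_trans yz1).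
  by rewrite ltxx.
- by rewrite rys andbT; apply/rootP.
- by rewrite zy; apply: sub_all lys => x; apply: lt_trans.
- apply/andP; split.
    rewrite !inE (gt_eqF zy) (lt_eqF yz1) /=; apply/negP.
    move/(allP (order_path_min lt_trans zs_lt)) => /(lt_trans yz1).
    by rewrite ltxx.
  apply/allP => x xys; rewrite in_cons negb_or (allP nys) // andbT.
  by rewrite (gt_eqF (lt_trans zz1 (allP lys _ xys))).
Qed.

(** Separates one copy of each root, for Rolle's theorem, from the repetitions, which survive in the
    derivative. *)
Lemma perm_undup_cat (T : eqType) (s : seq T) :
  exists2 r, perm_eq s (undup s ++ r) & {subset r <= s}.
Proof.
elim: s => [|x s [r sr rs]]; first by exists [::].
case: (boolP (x \in s)) => /= xs; rewrite ?xs ?(negPf xs).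
  exists (x :: r); last first.
    by move=> y; rewrite !inE => /orP[->|/rs ->]; rewrite ?orbT.
  by rewrite perm_sym perm_catC /= perm_cons perm_catC perm_sym.
exists r; last by move=> y /rs; rewrite inE orbC => ->.
by rewrite /= perm_cons.
Qed.

(** Each summand of the product rule lacks a single factor, which the product over [s] restores. *)
Lemma dvdp_deriv_prod_XsubC (r s : seq R) : {subset r <= s} ->
  \prod_(z <- r) ('X - z%:P) %|
    (\prod_(z <- r) ('X - z%:P))^`() * \prod_(z <- s) ('X - z%:P).
Proof.
elim: r => [|z r IH] rs; first by rewrite big_nil dvd1p.
rewrite big_cons derivM derivXsubC mul1r [X in _ %| X]mulrDl dvdp_add //.
- by rewrite mulrC dvdp_mul // dvdp_XsubCl root_prod_XsubC rs // mem_head.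
- rewrite -mulrA dvdp_mul2l ?polyXsubC_eq0 // IH // => y yr.
  by rewrite rs // inE yr orbT.
Qed.

(** Rolle's theorem with multiplicities: a root listed [n] times keeps [n - 1] copies and each gap
    between distinct roots gives one more, so only one factor is lost. *)
Lemma deriv_prod_XsubC_mul (zs : seq R) h : exists (ys : seq R) (q : {poly R}),
  [/\ size ys = (size zs).-1, (size q <= size h)%N
    & (\prod_(z <- zs) ('X - z%:P) * h)^`() = \prod_(y <- ys) ('X - y%:P) * q].
Proof.
have [->|h0] := eqVneq h 0.
  by exists (behead zs), 0; rewrite size_behead !mulr0 derivC.
case Ezs: zs => [|z' zs'].
  exists [::], h^`(); rewrite !big_nil !mul1r; split=> //.
  by rewrite ltnW // lt_size_deriv.
rewrite -Ezs.
have [r zs_r r_zs] := perm_undup_cat zs.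
have : sort <=%R (undup zs) =i zs by move=> y; rewrite mem_sort mem_undup.
have : perm_eq zs (sort <=%R (undup zs) ++ r).
  by rewrite (perm_trans zs_r) // perm_cat2r perm_sym perm_sort.
have : sorted <%R (sort <=%R (undup zs)).
  by rewrite sort_lt_sorted undup_uniq.
case: (sort _ _) => [|z s] s_lt zsE s_zs.
  by have := s_zs z'; rewrite Ezs mem_head.
set g := _ * h; pose P := \prod_(y <- r) ('X - y%:P).
have gE : g = P * (\prod_(y <- z :: s) ('X - y%:P) * h).
  by rewrite /g (perm_big _ zsE) big_cat /= -mulrA mulrCA.
have : P %| g^`().
  rewrite gE derivM dvdp_add ?dvdp_mulIl // mulrA dvdp_mulr //.
  by apply: dvdp_deriv_prod_XsubC => y; rewrite s_zs => /r_zs.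
case/dvdpP => g1 g'E.
have [] := @rolle_roots g z s s_lt.
  apply/allP => y ys; rewrite gE mulrCA rootM root_prod_XsubC.
  by rewrite ys.
move=> ys [sys uys rys _ nys].
(* The zeros from Rolle's theorem are not roots of [P], hence they are roots of the quotient
   [g1]. *)
have : \prod_(y <- ys) ('X - y%:P) %| g1.
  apply: uniq_roots_dvdp; last by rewrite uniq_rootsE.
  apply/allP => y yys; have := allP rys _ yys.
  rewrite g'E rootM => /orP[//|]; rewrite root_prod_XsubC => /r_zs.
  by rewrite -s_zs (negPf (allP nys _ yys)).
case/dvdpP => q g1E; exists (ys ++ r), q.
have g'E2 : g^`() = \prod_(y <- ys ++ r) ('X - y%:P) * q.
  by rewrite big_cat g'E g1E /= -/P [RHS]mulrC mulrA.
have szE : size (ys ++ r) = (size zs).-1.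
  by rewrite (perm_size zsE) !size_cat sys.
split=> //.
have [->|q0] := eqVneq q 0; first by rewrite size_poly0.
have g0 : g != 0.
  by rewrite mulf_neq0 // monic_neq0 // monic_prod_XsubC.
(* The strict drop in size under differentiation makes up for the lost factor and bounds [q]. *)
have := lt_size_deriv g0; rewrite g'E2.
rewrite !size_monicM ?monic_prod_XsubC // !size_prod_XsubC szE Ezs /=.
by rewrite !addSn /=; lia.
Qed.

(** By [k <= d] there is a linear factor to lose, possibly one at infinity. *)
Lemma split_deriv d k g :
  (k <= d)%N -> split_up_to d.+1 k g -> split_up_to d k g^`().
Proof.
move=> kd [s [h [s0 sk hk ->]]].
have [zs [c [c0 zs_s ->]]] := prod_affineE s0.
have [ys [q [ysE qh E]]] := deriv_prod_XsubC_mul zs (c *: h).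
rewrite -scalerAl scalerAr E.
have ysd : (size ys <= d - k)%N.
  by rewrite ysE leq_subRL // -ltnS -sk -addnS addnC leq_add2r; lia.
(* Factors [(0, 1)] at infinity, equal to [1] here, fill up the count. *)
exists ([seq (1, - y) | y <- ys] ++ nseq (d - k - size ys) (0, 1)), q; split.
- rewrite all_cat all_map all_nseq !xpair_eqE oner_eq0 andbF orbT andbT.
  by apply/allP => y _ /=; rewrite xpair_eqE oner_eq0.
- by rewrite size_cat size_map size_nseq subnKC // subnK.
- by rewrite (leq_trans qh) // size_scale.
- rewrite big_cat big_nseq big_map /affine /= scale0r add0r iter_mulr_1 expr1n.
  rewrite mulr1; congr (_ * _); apply: eq_bigr => y _.
  by rewrite scale1r polyCN.
Qed.

(** * Sums of powers with many real linear factors *)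

Lemma uniq_of_simple_roots g h (zs : seq R) :
  (forall z, root g z -> ~~ root g^`() z) ->
  g = \prod_(z <- zs) ('X - z%:P) * h -> uniq zs.
Proof.
move=> simple; elim: zs h => [//|z zs IH] h gE /=.
rewrite (IH (('X - z%:P) * h)) ?andbT; last first.
  by rewrite gE big_cons mulrA [_ * ('X - _)]mulrC.
apply/negP => zzs.
have rz : root (\prod_(z <- zs) ('X - z%:P) * h) z.
  by rewrite rootM root_prod_XsubC zzs.
have := simple z; rewrite gE big_cons -mulrA !rootM root_XsubC eqxx => /(_ isT).
rewrite derivM derivXsubC mul1r /root hornerD hornerM.
by rewrite !hornerE subrr mul0r addr0 -hornerM -/(root _ _) rz.
Qed.

Lemma size_binomial_affine d l (u : R * R) (m : R) :
  l != 0 -> u.1 != 0 -> (0 < d)%N ->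
  size (l *: affine u ^+ d + m%:P) = d.+1.
Proof.
move=> l0 u0 d0.
have su : size (affine u) = 2.
  rewrite size_polyDl size_scale // size_polyX //.
  by rewrite ltnS size_polyC_leq1.
have sE : size (l *: affine u ^+ d) = d.+1.
  rewrite size_scale // -[LHS]prednK ?size_exp ?su ?mul1n //.
  by rewrite lt0n size_poly_eq0 expf_neq0 // -size_poly_eq0 su.
by rewrite size_polyDl sE // ltnS (leq_trans (size_polyC_leq1 _)).
Qed.

(** For [d > 0], a real zero [z] satisfies [(u.1 z + u.2) ^+ d = - m / l], which fixes the absolute
    value of [u.1 z + u.2]. This leaves at most two zeros, simple because [m != 0]. *)
Lemma split_binomial d k l (u : R * R) (m : R) :
  l != 0 -> u.1 != 0 -> m != 0 ->
  split_up_to d k (l *: affine u ^+ d + m%:P) -> (d <= 2 + k)%N.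
Proof.
case: d => // d l0 u0 m0 [s [h [s0 sk hk]]]; set g := (X in X = _).
have [zs [c [c0 zs_s ->]]] := prod_affineE s0.
rewrite -scalerAl scalerAr => gE.
have sg : size g = d.+2 by apply: size_binomial_affine.
have h0 : c *: h != 0.
  by apply: contra_eq_neq sg => E; rewrite gE E mulr0 size_poly0.
(* Since [g] has full degree, no factor of [s] is at infinity. *)
have szs : (size s <= size zs)%N.
  move: sg; rewrite gE size_monicM ?monic_prod_XsubC // size_prod_XsubC.
  rewrite size_scale // addSn /= => - sgE.
  by rewrite -(leq_add2r k.+1) addnS sk -sgE leq_add2l.
rewrite -sk leq_add2r (leq_trans szs) //.
have uE z : (affine u).[z] = u.1 * z + u.2 by rewrite /affine !hornerE.
have gz z : root g z -> (u.1 * z + u.2) ^+ d.+1 = - m / l.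
  move=> /rootP; rewrite /g hornerD hornerC hornerZ horner_exp uE => /eqP.
  by rewrite addr_eq0 => /eqP <-; rewrite mulrAC divff ?mul1r.
have uzs : uniq zs.
  apply: uniq_of_simple_roots gE => z /gz E; apply/negP => /rootP.
  rewrite /g derivD derivC addr0 derivZ deriv_exp deriv_affine /=.
  rewrite hornerZ hornerMn hornerM hornerC horner_exp uE => /eqP.
  rewrite -mulr_natr !mulf_eq0 (negPf l0) (negPf u0) pnatr_eq0 /= orbF.
  move=> /eqP E0; move: E; rewrite exprS E0 mulr0 => /esym/eqP.
  by rewrite mulf_eq0 oppr_eq0 invr_eq0 (negPf m0) (negPf l0).
have rzs z : z \in zs -> root g z by rewrite gE rootM root_prod_XsubC => ->.
case: zs uzs rzs {gE szs zs_s} => [//|z0 zs] uzs rzs.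
(* The second candidate is the reflection of [z0] in the zero of [affine u]. *)
have sub : {subset z0 :: zs <= [:: z0; - z0 - 2 * u.2 / u.1]}.
  move=> z zzs; rewrite !inE.
  have E := etrans (gz z (rzs z zzs)) (esym (gz z0 (rzs z0 (mem_head _ _)))).
  have : `|u.1 * z + u.2| == `|u.1 * z0 + u.2|.
    by rewrite -(@eqrXn2 _ d.+1) ?normr_ge0 // -!normrX E.
  rewrite eqr_norm2 => /orP[|] /eqP E2; apply/orP; [left|right]; apply/eqP.
  - by apply: (mulfI u0); apply: (addIr u.2).
  - apply: (mulfI u0); apply: (addIr u.2); rewrite E2.
    by rewrite mulrBr mulrN; field.
exact: uniq_leq_size uzs sub.
Qed.

Definition deriv_term d (x : R * (R * R)) := (x.1 * d%:R * x.2.1, x.2).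

Lemma deriv_power_term d x :
  (power_term d.+1 x)^`() = power_term d (deriv_term d.+1 x).
Proof.
rewrite /power_term derivZ deriv_exp deriv_affine /= mul_polyC.
by rewrite -scaler_nat !scalerA mulrA.
Qed.

(* Rotating the zero of [affine w.2] to infinity makes the term [w] constant, so
   that differentiating removes it while Rolle's theorem keeps [k]. *)
Lemma power_sum_split d k x y (t : seq (R * (R * R))) :
  x.1 != 0 -> y.1 != 0 -> det2 x.2 y.2 != 0 ->
  all (fun z => det2 x.2 z.2 != 0) t -> all (fun z => det2 y.2 z.2 != 0) t ->
  split_up_to d k (\sum_(z <- [:: x, y & t]) power_term d z) ->
  (d <= (size t).+2 + k)%N.
Proof.
move sz_t: (size t) => n.
elim: n t sz_t d x y => [|n IH] [|w t] //= => [_|[sz_t]] d x y x0 y0 xy.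
  (* With two terms left, moving the zero of [y.2] to infinity makes the term [y] a nonzero
     constant. *)
  have y0' : y.2 != (0, 0) by rewrite (@det2_neq0l _ _ x.2) // det2C oppr_eq0.
  move=> _ _ /(split_rotate y0').
  rewrite rotate_power_sum !big_cons big_nil addr0.
  rewrite [X in _ + X](_ : _ = (y.1 * (rot y.2 y.2).2 ^+ d)%:P).
    apply: split_binomial => //.
    rewrite mulf_neq0 // expf_neq0 //= -!expr2 sqr_norm_neq0 //.
  rewrite /power_term /affine /= det2xx scale0r add0r.
  by rewrite polyCM polyC_exp mul_polyC.
move=> /andP[xw xt] /andP[yw yt].
(* If [k] exceeds [d.-1], the bound is immediate. *)
have [kd|] := leqP k d.-1; last by lia.
case: d kd => [//|d /= kd].
have w0 : w.2 != (0, 0) by rewrite (@det2_neq0l _ _ x.2) // det2C oppr_eq0.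
move=> /(split_rotate w0) /(split_deriv kd).
rewrite rotate_power_sum raddf_sum /=.
under eq_bigr do rewrite deriv_power_term.
set D := fun z => deriv_term d.+1 (z.1, rot w.2 z.2).
rewrite (_ : \sum_(_ <- _) _ =
    \sum_(z <- [:: D x, D y & map D t]) power_term d z); last first.
  rewrite !big_cons big_map; congr (_ + (_ + _)).
  rewrite /power_term /deriv_term /= det2xx mulr0 scale0r.
  by rewrite add0r.
have detD a b : det2 a.2 b.2 != 0 -> det2 (D a).2 (D b).2 != 0.
  by move=> ab; rewrite /= det2_rot mulf_neq0 // sqr_norm_neq0.
(* After rotation the leading coefficient of a form is its determinant with [w.2], so the pivots
   survive differentiation. *)
have D0 a : a.1 != 0 -> det2 a.2 w.2 != 0 -> (D a).1 != 0.
  by move=> a0 aw; rewrite /= !mulf_neq0 ?pnatr_eq0.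
rewrite addSn ltnS => /IH; apply; rewrite ?size_map ?detD ?D0 //.
- by rewrite all_map; apply: sub_all xt => z; exact: detD.
- by rewrite all_map; apply: sub_all yt => z; exact: detD.
Qed.

End Rolle.

(** * Binary forms and their dehomogenisations *)

Section Dehomogenisation.

Variable F : numFieldType.

Implicit Types (f q : {mpoly F[2]}) (A B : {poly F}).

(** The two charts of the projective line are [('X, 1)] and [(1, 'X)]. *)
Definition dehomog A B f : {poly F} :=
  mmap (@polyC F) (fun i : 'I_2 => if i == ord0 then A else B) f.

HB.instance Definition _ A B := GRing.RMorphism.copy (dehomog A B)
  (mmap (@polyC F) (fun i : 'I_2 => if i == ord0 then A else B)).

Lemma dehomogZ A B c f : dehomog A B (c *: f) = c *: dehomog A B f.
Proof. by rewrite /dehomog mmapZ mul_polyC. Qed.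

Lemma dehomogX0 A B : dehomog A B 'X_ord0 = A.
Proof. by rewrite /dehomog mmapX mmap1U. Qed.

Lemma dehomogX1 A B : dehomog A B 'X_ord_max = B.
Proof. by rewrite /dehomog mmapX mmap1U. Qed.

Lemma dehomog_form_subst d g A B :
  dehomog A B (form_subst d g 'X_ord0 'X_ord_max) = form_subst d g A B.
Proof.
rewrite /form_subst rmorph_sum; apply: eq_bigr => i _.
by rewrite /= dehomogZ rmorphM !rmorphXn /= dehomogX0 dehomogX1.
Qed.

Lemma form_substXn (S : comAlgType F) d i (a b : S) : (i <= d)%N ->
  form_subst d 'X^i a b = a ^+ i * b ^+ (d - i).
Proof.
rewrite -ltnS => id; rewrite /form_subst (bigD1 (Ordinal id)) //= coefXn eqxx.
rewrite scale1r big1 ?addr0 // => j ji; rewrite coefXn.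
by rewrite (_ : (_ == _) = false) ?scale0r //; apply: negbTE ji.
Qed.

Lemma mnm2_sum (m : 'X_{1..2}) : mdeg m = (m ord0 + m ord_max)%N.
Proof.
rewrite mdegE big_ord_recl big_ord1; congr (_ + m _)%N.
exact/val_inj.
Qed.

Lemma dehomog_sum f :
  dehomog 'X 1 f = \sum_(m <- msupp f) f@_m *: 'X^(m ord0).
Proof.
rewrite /dehomog /mmap; apply: eq_bigr => m _.
by rewrite mul_polyC /mmap1 big_ord_recl big_ord1 /= expr1n mulr1.
Qed.

Lemma size_dehomog d f : f \is d.-homog -> (size (dehomog 'X 1 f) <= d.+1)%N.
Proof.
move=> /dhomogP fd; rewrite dehomog_sum (leq_trans (size_sum _ _ _)) //.
apply/bigmax_leqP_seq => m /fd <- _.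
by rewrite (leq_trans (size_scale_leq _ _)) // size_polyXn ltnS /= mnm2_sum
   leq_addr.
Qed.

(** In a fixed degree the exponent of [X] determines that of [Y], so the chart loses nothing. *)
Lemma rehomog d f : f \is d.-homog ->
  form_subst d (dehomog 'X 1 f) 'X_ord0 'X_ord_max = f.
Proof.
move=> /dhomogP fd; rewrite dehomog_sum form_subst_sum [RHS]mpolyE !big_seq.
apply: eq_bigr => m /fd /= <-.
rewrite form_substZ mnm2_sum form_substXn ?leq_addr //.
rewrite addKn [in RHS]mpolyXE_id big_ord_recl big_ord1.
by have -> : lift ord0 ord0 = ord_max :> 'I_2 by apply/val_inj.
Qed.

Lemma dehomog_neq0 d f : f \is d.-homog -> f != 0 -> dehomog 'X 1 f != 0.
Proof.
move=> /rehomog fE; apply: contra_neq => E; rewrite -fE E.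
by rewrite -[0](scale0r 0) form_substZ scale0r.
Qed.

(** A form reduced to a constant at [Y = 1] is a multiple of [Y ^+ d.+1], whose positive degree
    shows in the other chart. *)
Lemma dehomog_swap_gt1 d q : q \is d.+1.-homog -> q != 0 ->
  (size (dehomog 'X 1 q) <= 1)%N -> (1 < size (dehomog 1 'X q))%N.
Proof.
move=> qd q0 /size1_polyC qE; have := dehomog_neq0 qd q0.
rewrite -[in X in _ -> X](rehomog qd) dehomog_form_subst qE.
rewrite polyC_eq0 => c0; rewrite -[_%:P]mulr1 mul_polyC form_substZ.
by rewrite -(expr0 'X) form_substXn // mul1r subn0 size_scale // size_polyXn.
Qed.

Lemma dehomog_linear l : l \is 1.-homog -> l != 0 ->
  exists2 w : F * F, w != (0, 0) & dehomog 'X 1 l = affine w.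
Proof.
move=> l1 l0; have := size_dehomog l1; have := dehomog_neq0 l1 l0.
set g := dehomog _ _ _ => g0 sg.
have gE : g = affine (g`_1, g`_0).
  apply/polyP => i; rewrite coefD coefZ coefX coefC /=.
  case: i => [|[|i]] /=; rewrite ?mulr0 ?mulr1 ?add0r ?addr0 //.
  by rewrite nth_default // (leq_trans sg).
exists (g`_1, g`_0) => //; apply: contra_neq g0 => E.
by rewrite gE E /affine /= scale0r add0r.
Qed.

Lemma dehomog_linear_form (a b : F) :
  dehomog 'X 1 (linear_form a b) = affine (a, b).
Proof.
rewrite /linear_form rmorphD /= !dehomogZ dehomogX0 dehomogX1.
by rewrite /affine alg_polyC.
Qed.

Lemma dehomog_linear_form_swap (a b : F) :
  dehomog 1 'X (linear_form a b) = affine (b, a).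
Proof.
rewrite /linear_form rmorphD /= !dehomogZ dehomogX0 dehomogX1 /affine alg_polyC.
by rewrite addrC.
Qed.

Lemma dhomog_bigprod n I (r : seq I) (G : I -> {mpoly F[n]}) (e : I -> nat) :
  (forall i, G i \is (e i).-homog) ->
  \prod_(i <- r) G i \is (\sum_(i <- r) e i)%N.-homog.
Proof.
move=> Ge; elim: r => [|i r IH]; first by rewrite !big_nil dhomog1.
by rewrite !big_cons dhomogM.
Qed.

Lemma linear_form_homog (a b : F) : linear_form a b \is 1.-homog.
Proof. by rewrite /linear_form dhomogD // dhomogZ // dhomogX /= mdeg1. Qed.

End Dehomogenisation.

(** * Shortest decompositions *)

Section MinimalDecomposition.

Variables (F : numFieldType) (d r : nat) (f : {mpoly F[2]}).
Variables (lam al be : 'I_r -> F).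
Hypothesis fE : f = \sum_(j < r) lam j *: linear_form (al j) (be j) ^+ d.

(** Term [i] is absorbed into the coefficient of term [j]; [mu = 0] serves to discard a zero
    term. *)
Lemma waring_merge (i j : 'I_r) (mu : F) : i != j ->
  lam i *: linear_form (al i) (be i) ^+ d =
    mu *: linear_form (al j) (be j) ^+ d ->
  waring_decomposable d f r.-1.
Proof.
move=> ij E; have [k0 j_k0 _] := unlift_some ij.
exists (fun k => lam (lift i k) + (if k == k0 then mu else 0)),
  (al \o lift i), (be \o lift i).
under eq_bigr do rewrite scalerDl.
rewrite big_split /= [X in _ + X](bigD1 k0) //= eqxx -j_k0 -E.
rewrite [X in _ + (_ + X)]big1 ?addr0; last first.
  by move=> k /negPf ->; rewrite scale0r.
by rewrite fE (bigD1_ord i) //= addrC.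
Qed.

Hypothesis r_min : forall s, waring_decomposable d f s -> (r <= s)%N.

Lemma minimal_coef_neq0 (i j : 'I_r) : i != j -> lam i != 0.
Proof.
move=> ij; apply/eqP => li0.
have /r_min : waring_decomposable d f r.-1.
  by apply: (@waring_merge i j 0 ij); rewrite li0 !scale0r.
by rewrite leqNgt ltn_predL (leq_ltn_trans _ (ltn_ord i)).
Qed.

Lemma minimal_det2_neq0 (i j : 'I_r) : i != j ->
  det2 (al i, be i) (al j, be j) != 0.
Proof.
move=> ij; apply/eqP; rewrite /det2 /= => /eqP; rewrite subr_eq0 => /eqP det0.
(* The indices are left open because their roles are exchanged when the form of index [j] is zero,
   being then [0] times the other. *)
suff [[i' j'] /= ij' [c E]] : exists2 ij : 'I_r * 'I_r, ij.1 != ij.2 &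
    exists c,
      linear_form (al ij.1) (be ij.1) = c *: linear_form (al ij.2) (be ij.2).
  have /r_min : waring_decomposable d f r.-1.
    apply: (@waring_merge i' j' (lam i' * c ^+ d) ij').
    by rewrite E exprZn scalerA.
  by rewrite leqNgt ltn_predL (leq_ltn_trans _ (ltn_ord i)).
have [aj|aj] := eqVneq (al j) 0; last first.
  exists (i, j) => //; exists (al i / al j) => /=.
  rewrite /linear_form scalerDr !scalerA divfK //; congr (_ + _ *: _).
  by rewrite mulrAC det0 mulfK.
have [bj|bj] := eqVneq (be j) 0; last first.
  exists (i, j) => //; exists (be i / be j) => /=.
  rewrite /linear_form scalerDr !scalerA divfK //; congr (_ *: _ + _).
  by rewrite mulrAC -det0 mulfK.
exists (j, i); rewrite 1?eq_sym //=; exists 0.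
by rewrite /linear_form aj bj !scale0r addr0.
Qed.

Lemma power_terms_of_decomposition (i j : 'I_r) : i != j ->
  exists t : seq 'I_r, [/\ (size t).+2 = r, all (fun k => i != k) t,
    all (fun k => j != k) t &
    f = \sum_(k <- [:: i, j & t]) lam k *: linear_form (al k) (be k) ^+ d].
Proof.
move=> ij; have : i \in enum 'I_r by rewrite mem_enum.
move=> /perm_to_rem Pi.
have : j \in rem i (enum 'I_r).
  by rewrite mem_rem_uniq ?enum_uniq // inE /= eq_sym ij mem_enum.
move=> /perm_to_rem Pj; set t := rem j _ in Pj; exists t.
have P : perm_eq (enum 'I_r) [:: i, j & t].
  by rewrite (perm_trans Pi) // perm_cons.
have := enum_uniq 'I_r; rewrite (perm_uniq P) /= inE negb_or -andbA.
move=> /and4P[_ it jt _]; split.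
- by rewrite -[RHS]size_enum_ord (perm_size P).
- by apply/allP => k kt; apply: contraNneq it => ->.
- by apply/allP => k kt; apply: contraNneq jt => ->.
- by rewrite fE -big_enum (perm_big _ P).
Qed.

End MinimalDecomposition.

(** * From decompositions to lower bounds for the rank *)

Lemma split_prod (R : rcfType) I (r : seq I) (w : I -> R * R) (m : I -> nat)
    (k : nat) (h : {poly R}) :
  (forall i, w i != (0, 0)) -> (size h <= k.+1)%N ->
  split_up_to (\sum_(i <- r) m i + k) k
    (\prod_(i <- r) affine (w i) ^+ m i * h).
Proof.
move=> w0 hk; exists (flatten [seq nseq (m i) (w i) | i <- r]), h; split=> //.
- elim: r => //= i r IH; rewrite all_cat IH andbT.
  by apply/allP => u; rewrite mem_nseq => /andP[_ /eqP ->].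
- rewrite size_flatten /shape -map_comp sumnE big_map; congr (_ + _)%N.
  by apply: eq_bigr => i _; rewrite /= size_nseq.
- rewrite big_flatten big_map; congr (_ * _); apply: eq_bigr => i _.
  by rewrite big_nseq iter_mulr_1.
Qed.

Lemma waring_rank_gt1 (F : numFieldType) d (f : {mpoly F[2]}) :
  f \is d.-homog -> f != 0 -> ~ is_scaled_power d f -> (1 < waring_rank d f)%N.
Proof.
move=> fd f0 fN; have [] := waring_rankP fd.
case: (waring_rank d f) => [|[|//]].
  by case=> [? [? [? E]]]; rewrite E big_ord0 eqxx in f0.
case=> [lam [al [be E]]] _; case: fN.
exists (lam ord0), (linear_form (al ord0) (be ord0)).
by rewrite linear_form_homog E big_ord1.
Qed.

(** Two pivots are singled out for both bounds, whose inductions use only determinants against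
    them. *)
Lemma waring_rank_terms (F : numFieldType) d (f : {mpoly F[2]}) :
  f \is d.-homog -> f != 0 -> ~ is_scaled_power d f ->
  exists x y (t : seq (F * (F * F))),
    [/\ (size t).+2 = waring_rank d f,
        [/\ x.1 != 0, y.1 != 0 & det2 x.2 y.2 != 0],
        all (fun z => det2 x.2 z.2 != 0) t, all (fun z => det2 y.2 z.2 != 0) t &
        f = \sum_(z <- [:: x, y & t]) z.1 *: linear_form z.2.1 z.2.2 ^+ d].
Proof.
move=> fd f0 fN; have r1 := waring_rank_gt1 fd f0 fN.
have [[lam [al [be fS]]] r_min] := waring_rankP fd.
have : Ordinal (ltnW r1) != Ordinal r1 by [].
set i := Ordinal _; set j := Ordinal _ => ij.
have ji : j != i by rewrite eq_sym.
have [t [sz_t it jt ftS]] := power_terms_of_decomposition fS ij.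
have det0 := minimal_det2_neq0 fS r_min.
pose T k := (lam k, (al k, be k)); exists (T i), (T j), (map T t); split.
- by rewrite size_map.
- rewrite (minimal_coef_neq0 fS r_min ij) (minimal_coef_neq0 fS r_min ji).
  by rewrite det0.
- by rewrite all_map; apply: sub_all it => k; exact: det0.
- by rewrite all_map; apply: sub_all jt => k; exact: det0.
- by rewrite -[[:: T i, T j & _]]/(map T [:: i, j & t]) big_map.
Qed.

Lemma dehomog_power_sum (F : numFieldType) d (t : seq (F * (F * F))) :
  dehomog 'X 1 (\sum_(z <- t) z.1 *: linear_form z.2.1 z.2.2 ^+ d) =
  \sum_(z <- t) power_term d z.
Proof.
rewrite rmorph_sum; apply: eq_bigr => -[c [u v]] _ /=.
by rewrite dehomogZ rmorphXn /= dehomog_linear_form.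
Qed.

(** Exchanges the two variables, for the chart [X = 1]. *)
Definition swap_term (F : Type) (z : F * (F * F)) := (z.1, (z.2.2, z.2.1)).

Lemma dehomog_power_sum_swap (F : numFieldType) d (t : seq (F * (F * F))) :
  dehomog 1 'X (\sum_(z <- t) z.1 *: linear_form z.2.1 z.2.2 ^+ d) =
  \sum_(z <- map (@swap_term F) t) power_term d z.
Proof.
rewrite big_map rmorph_sum; apply: eq_bigr => -[c [u v]] _ /=.
by rewrite dehomogZ rmorphXn /= dehomog_linear_form_swap.
Qed.

(* A power of [Y] dehomogenises to a constant at [Y = 1], but not at [X = 1]. *)
Lemma waring_rank_gt_multiplicity (F : numFieldType) d e k
    (f q g : {mpoly F[2]}) :
  f \is d.-homog -> f != 0 -> ~ is_scaled_power d f ->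
  q \is k.+1.-homog -> q != 0 -> (e <= d)%N -> f = q ^+ e * g ->
  (e < waring_rank d f)%N.
Proof.
move=> fd f0 fN qk q0 ed fE.
have [x [y [t [<- [x0 y0 xy] xt yt fS]]]] := waring_rank_terms fd f0 fN.
have [q1|q1] := leqP (size (dehomog 'X 1 q)) 1; last first.
  apply: power_sum_multiplicity x0 y0 xy xt yt q1 ed _.
  by rewrite -dehomog_power_sum -fS fE rmorphM rmorphXn dvdp_mulIl.
have detS u v : det2 u.2 v.2 != 0 -> det2 (swap_term u).2 (swap_term v).2 != 0.
  by rewrite -oppr_eq0 /det2 opprB.
rewrite -(size_map (@swap_term F)).
have := dehomog_swap_gt1 qk q0 q1.
move/(@power_sum_multiplicity F d e _ (swap_term x) (swap_term y)); apply=> //.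
- exact: detS.
- by rewrite all_map; apply: sub_all xt => z; exact: detS.
- by rewrite all_map; apply: sub_all yt => z; exact: detS.
- rewrite -[[:: swap_term x, swap_term y & _]]/(map (@swap_term F)
    [:: x, y & t]).
  by rewrite -dehomog_power_sum_swap -fS fE rmorphM rmorphXn dvdp_mulIl.
Qed.

Lemma waring_rank_ge_real_roots (R : rcfType) d k (f : {mpoly R[2]}) :
  f \is d.-homog -> f != 0 -> ~ is_scaled_power d f ->
  split_up_to d k (dehomog 'X 1 f) -> (d <= waring_rank d f + k)%N.
Proof.
move=> fd f0 fN.
have [x [y [t [<- [x0 y0 xy] xt yt fS]]]] := waring_rank_terms fd f0 fN.
by rewrite fS dehomog_power_sum; exact: power_sum_split.
Qed.

Theorem corollary3p4 (R : realType) (d : nat) (f : {mpoly R[2]})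
    (a b : nat)
    (l : 'I_a -> {mpoly R[2]}) (m : 'I_a -> nat)
    (p : 'I_b -> {mpoly R[2]}) (n : 'I_b -> nat)
    (f_form : f \is d.-homog)
    (f_neq0 : f != 0)
    (f_not_power : ~ is_scaled_power d f)
    (l_linear : forall i, l i \is 1.-homog)
    (l_neq0 : forall i, l i != 0)
    (l_distinct : forall i j, i != j -> ~ proportional (l i) (l j))
    (m_gt0 : forall i, (0 < m i)%N)
    (p_quadratic : forall k, p k \is 2.-homog)
    (p_irreducible : forall k, irreducible_element (p k))
    (p_distinct : forall j k, j != k -> ~ proportional (p j) (p k))
    (n_gt0 : forall k, (0 < n k)%N)
    (f_factorization :
       f = \prod_(i < a) l i ^+ m i * \prod_(k < b) p k ^+ n k) :
  (maxn (\sum_(i < a) m i)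
        (maxn (\max_(i < a) m i) (\max_(k < b) n k) + 1)
     <= waring_rank d f)%N.
Proof.
have p_neq0 k : p k != 0 by case: (p_irreducible k).
set q := \prod_(k < b) _ in f_factorization.
have q_form : q \is (\sum_(k < b) 2 * n k)%N.-homog.
  by apply: dhomog_bigprod => k; apply: dhomogMn.
have l_form : \prod_(i < a) l i ^+ m i \is (\sum_(i < a) m i)%N.-homog.
  apply: dhomog_bigprod => i; have := dhomogMn (m i) (l_linear i).
  by rewrite mul1n.
have dE : d = (\sum_(i < a) m i + \sum_(k < b) 2 * n k)%N.
  by apply: (dhomog_uniq f_neq0 f_form); rewrite f_factorization dhomogM.
have m_mult i : (m i < waring_rank d f)%N.
  apply: (@waring_rank_gt_multiplicity _ _ _ 0 f (l i)
    (\prod_(j < a | j != i) l j ^+ m j * q)) => //.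
    by rewrite dE (bigD1 i) //= -addnA leq_addr.
  by rewrite f_factorization (bigD1 i) //= mulrA.
have n_mult k : (n k < waring_rank d f)%N.
  apply: (@waring_rank_gt_multiplicity _ _ _ 1 f (p k)
    (\prod_(i < a) l i ^+ m i * \prod_(j < b | j != k) p j ^+ n j)) => //.
    by rewrite dE (bigD1 k) //= mul2n -addnn; lia.
  by rewrite f_factorization /q (bigD1 k) //= mulrCA.
have m_sum : (\sum_(i < a) m i <= waring_rank d f)%N.
  have /choice[w wP] : forall i, exists w : R * R,
      w != (0, 0) /\ dehomog 'X 1 (l i) = affine w.
    by move=> i; have [w] := dehomog_linear (l_linear i) (l_neq0 i); exists w.
  (* The quadratic factors stay together as the cofactor; adding its degree to both sides gives the
     real root bound. *)
  rewrite -(leq_add2r (\sum_(k < b) 2 * n k)) -dE.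
  apply: waring_rank_ge_real_roots => //.
  rewrite dE f_factorization rmorphM rmorph_prod.
  under eq_bigr => i _ do rewrite rmorphXn /= (wP i).2.
  by apply: split_prod (size_dehomog q_form) => i; case: (wP i).
(* The rank is positive, hence some [w.+1], and strict bounds become bounds by [w]; empty maxima are
   [0] and obey them too. *)
move: (waring_rank_gt1 f_form f_neq0 f_not_power) m_mult n_mult m_sum.
case: (waring_rank d f) => // w _ m_mult n_mult m_sum.
rewrite geq_max m_sum addn1 ltnS geq_max /=.
apply/andP; split; apply/bigmax_leqP => i _.
- exact: m_mult.
- exact: n_mult.
Qed.
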